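(* Let $f:\mathbb{R}_{\geq 0}^A\to\mathbb{R}_{\geq 0}$ be a CDR-valuation, $\gamma\in[0,1]$, and suppose $U$ is $\gamma$-balanced with respect to $f$. Then for an instance of OCDRA with objective $f$, the continuous greedy algorithm with respect to $U$ is $\gamma$-competitive: the final allocation $\mathbf{x}$ it outputs satisfies $f(\mathbf{x})\ge\gamma f(\mathbf{x}^* )$ for every feasible allocation $\mathbf{x}^*\in\mathbb{R}_{\geq 0}^A$ (i.e., with $\sum_{a\in A_j}x^*_a\le 1$ for all $j$).
   Context: Functions $g:\mathbb{R}_{\geq 0}^A\to\mathbb{R}_{\geq 0}$ are assumed upward-differentiable: for every $\mathbf{x}$ there is $\nabla g(\mathbf{x})\in\mathbb{R}^A$ with $\lim_{\epsilon\to 0^+}(g(\mathbf{x}+\epsilon\mathbf{y})-g(\mathbf{x}))/\epsilon=\langle\nabla g(\mathbf{x}),\mathbf{y}\rangle$ for all $\mathbf{y}\in\mathbb{R}_{\geq 0}^A$. A CDR-valuation is such a $g$ with $g(0)=0$, $g$ monotone increasing, concave, and $\nabla g$ monotone decreasing coordinate-wise. For concave $f$, $\hat f(\alpha)=\sup_{\mathbf{x}\in\mathbb{R}_{\geq 0}^A}(f(\mathbf{x})-\langle\alpha,\mathbf{x}\rangle)$. $U$ is $\gamma$-balanced with respect to $f$ if $U$ is a CDR-valuation on $\mathbb{R}_{\geq 0}^A$ and $\frac{1}{\gamma}f(\mathbf{x})\ge U(\mathbf{x})+\hat f(\nabla U(\mathbf{x}))$ for all $\mathbf{x}\in\mathbb{R}_{\geq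 0}^A$. OCDRA instance: divisible items $j\in[n]$ arrive online; item $j$ reveals a finite set $A_j$ of options (the $A_j$ pairwise disjoint, $A=\bigcup_j A_j$); the algorithm irrevocably chooses $(x_a)_{a\in A_j}$ with $x_a\ge0$, $\sum_{a\in A_j}x_a\le1$; the objective is $f(\mathbf{x})$. Continuous greedy with respect to $U$: when item $j$ arrives, initialize $x_a=0$ for $a\in A_j$; over the time interval $t\in[0,1]$, continuously choose $a_t\in\arg\max_{a\in A_j}\partial U(\mathbf{x})/\partial x_a$ (evaluated at the current $\mathbf{x}$) and increase $x_{a_t}$ by $dt$; after all items, return $\mathbf{x}$. *)

(* Defs.v *)
From HB Require Import structures.
From mathcomp Require Import all_boot all_order all_algebra.
From mathcomp Require Import all_classical all_reals all_analysis.

Set Implicit Arguments.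
Unset Strict Implicit.
Unset Printing Implicit Defensive.

Import Order.TTheory GRing.Theory Num.Theory.
Import numFieldNormedType.Exports.

Local Open Scope classical_set_scope.
Local Open Scope ring_scope.

(* Functions on the orthant are total functions on {ffun A -> R}; nothing below
   looks at their values outside the orthant. *)
Section Valuations.
Context {R : realType} {A : finType}.
Implicit Types (f g U : {ffun A -> R} -> R) (x y v alpha : {ffun A -> R}).

Definition orthant : set {ffun A -> R} := [set x | forall a, 0 <= x a].

Definition dot x y : R := \sum_a x a * y a.

Definition is_upward_gradient g x v : Prop :=
  forall y, orthant y ->
    (g (x + e *: y) - g x) / e @[e --> 0^'+] --> dot v y.

Definition upward_differentiable g : Prop :=
  forall x, orthant x -> exists v, is_upward_gradient g x v.

(* The upward gradient is unique when it exists: take y to be a unit vector. *)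
Definition grad g x : {ffun A -> R} := xget 0 (is_upward_gradient g x).

Record CDR_valuation g : Prop := {
  cdr_ge0 : forall x, orthant x -> 0 <= g x;
  cdr_diff : upward_differentiable g;
  cdr_0 : g 0 = 0;
  cdr_monotone : forall x y, orthant x -> orthant y ->
    (forall a, x a <= y a) -> g x <= g y;
  cdr_concave : convex_function orthant (fun x => - g x);
  cdr_grad_antitone : forall x y, orthant x -> orthant y ->
    (forall a, x a <= y a) -> forall a, grad g y a <= grad g x a
}.

(* The supremum may be +oo, hence the extended reals. *)
Definition fhat f alpha : \bar R :=
  ereal_sup [set (f x - dot alpha x)%:E | x in orthant].

(* For gamma = 0 the inverse is the extended real +oo. *)
Definition balanced (gamma : R) f U : Prop :=
  CDR_valuation U /\
  forall x, orthant x ->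
    ((U x)%:E + fhat f (grad U x) <= gamma%:E^-1 * (f x)%:E)%E.

End Valuations.

Section OCDRA.
Context {R : realType} {A : finType}.
Implicit Types (U : {ffun A -> R} -> R) (x y : {ffun A -> R}) (S : {set A}).

(* [opts j] is the option set of the j-th item to arrive. *)
Definition ocdra_instance (n : nat) (opts : 'I_n -> {set A}) : Prop :=
  (forall i j, i != j -> opts i :&: opts j = finset.set0) /\
  (forall a, exists j, a \in opts j).

Definition feasible (n : nat) (opts : 'I_n -> {set A}) x : Prop :=
  orthant x /\ forall j, \sum_(a in opts j) x a <= 1.

Definition greedy_option U S x : set A :=
  [set a | a \in S /\ forall b, b \in S -> grad U x b <= grad U x a].

(* One arrival, taking the allocation from x to y along the path X. At time t
   the unit of flow is spread by the rates [rho t] over the maximizing options.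
   Choosing a single option a_t is the case where rho t is the indicator of
   a_t; rates are needed because, when several options stay tied, the
   continuous limit splits the flow between them and need not be given by any
   t |-> a_t. An item without options leaves the allocation unchanged. *)
Definition greedy_arrival U S x y : Prop :=
  exists (X rho : R -> {ffun A -> R}),
    [/\ forall a, measurable_fun (`[0, 1] : set R) (fun t : R => rho t a),
        forall t, 0 <= t <= 1 ->
          [/\ forall a, 0 <= rho t a,
              forall a, rho t a != 0 -> greedy_option U S (X t) a
            & \sum_a rho t a = (S != finset.set0)%:R],
        forall t, 0 <= t <= 1 -> forall a,
          X t a = x a + \int[lebesgue_measure]_(s in `[0, t]) rho s a
      & y = X 1].

(* [xs j] is the allocation just before the j-th item arrives. Options of items
   that have not arrived carry the value 0. *)
Definition continuous_greedy U (n : nat) (opts : 'I_n -> {set A}) x : Prop :=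
  exists xs : nat -> {ffun A -> R},
    [/\ xs 0%N = 0,
        forall j : 'I_n, greedy_arrival U (opts j) (xs j) (xs j.+1)
      & xs n = x].

End OCDRA.

(* Main.v *)
(* Write x for the output. Moving the unit of flow of item j raises U by at
   least the largest marginal of U over the options of j at x, because the flow
   follows the largest marginals and these only decrease along the run. Summing
   over the items gives U x >= <grad U x, xstar>, and bounding fhat from below
   by its value at xstar turns the balance condition at x into
   f x / gamma >= U x + f xstar - <grad U x, xstar> >= f xstar. *)
Require Import Defs.
From mathcomp Require Import all_boot all_order all_algebra.
From mathcomp Require Import all_classical all_reals all_analysis.
From mathcomp Require Import ring lra zify.
Import Order.TTheory GRing.Theory Num.Theory.
Import numFieldNormedType.Exports.
Local Open Scope ring_scope.

(** * Concavity bounds for upward gradients *)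

Lemma gradP {R : realType} {A : finType} {g : {ffun A -> R} -> R}
    {x : {ffun A -> R}} :
  upward_differentiable g -> orthant x -> is_upward_gradient g x (grad g x).
Proof. by move=> hg /hg; exact: xgetPex. Qed.

Lemma orthant_le {R : realType} {A : finType} {x y : {ffun A -> R}} :
  orthant x -> (forall a, x a <= y a) -> orthant y.
Proof. by move=> x0 xy a; exact: le_trans (x0 a) (xy a). Qed.

Lemma dot_le {R : realType} {A : finType} (u v d : {ffun A -> R}) :
  orthant d -> (forall a, u a <= v a) -> dot u d <= dot v d.
Proof. by move=> d0 uv; apply: ler_sum => a _; exact: ler_wpM2r. Qed.

(* The three-chord inequality, with the denominators s and e cleared. *)
Lemma concave_chord {R : realType} {A : finType} {g : {ffun A -> R} -> R}
    {x d : {ffun A -> R}} {s e : R} :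
  convex_function orthant (fun x => - g x) -> orthant x -> orthant d ->
  0 < s -> 0 < e ->
  s * (g (x + s *: d + e *: d) - g (x + s *: d))
    <= e * (g (x + s *: d) - g x).
Proof.
move=> hg x0 d0 s0 e0.
have se0 : 0 < s + e by rewrite addr_gt0.
(* With this weight on [x], the convex combination of [x] and [x + s *: d + e *: d] is
   [x + s *: d]. *)
have t0 : 0 <= e / (s + e) by rewrite divr_ge0 ?ltW.
have t1 : e / (s + e) <= 1 by rewrite ler_pdivrMr// mul1r lerDr ltW.
pose t : {i01 R} := Itv01 t0 t1.
have hx : x \in (orthant : set {ffun A -> R}) by rewrite inE.
have hy : x + s *: d + e *: d \in (orthant : set {ffun A -> R}).
  rewrite inE => a; rewrite !ffunE.
  by rewrite !addr_ge0 // mulr_ge0 // ltW.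
have /= := hg t x (x + s *: d + e *: d) hx hy.
have -> : conv t (x : convex_lmodType {ffun A -> R}) (x + s *: d + e *: d) =
    x + s *: d.
  apply/ffunP => a.
  rewrite /conv/= !ffunE /unstable.onem /GRing.scale/=.
  field; lra.
rewrite /conv/= /unstable.onem /GRing.scale/=.
set P := g (x + _ + _); set Q := g (x + _).
rewrite -(ler_pM2r se0).
have -> : (e / (s + e) * - g x + (1 - e / (s + e)) * - P) * (s + e) =
  - e * g x - s * P by field; lra.
lra.
Qed.

(** By concavity the slope just past an intermediate point [z] of the segment is at most the mean
    slope from [x] to [z]. The antitone gradient and the monotonicity of [U] pass from [z] to [y],
    and [z] may be arbitrarily close to [y]. *)
Lemma grad_le_increment {R : realType} {A : finType} {U : {ffun A -> R} -> R}
    {x y : {ffun A -> R}} :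
  CDR_valuation U -> orthant x -> (forall a, x a <= y a) ->
  dot (grad U y) (y - x) <= U y - U x.
Proof.
move=> hU x0 xy.
have y0 := orthant_le x0 xy.
set d := y - x.
have d0 : orthant d by move=> a; rewrite !ffunE subr_ge0.
have main s : 0 < s < 1 -> s * dot (grad U y) d <= U y - U x.
  move=> /andP[s0 s1]; set z := x + s *: d.
  have z0 : orthant z.
    by move=> a; rewrite 2!ffunE addr_ge0 // mulr_ge0 // ltW.
  have zy a : z a <= y a.
    have da : 0 <= y a - x a by rewrite subr_ge0.
    rewrite !ffunE /GRing.scale/=.
    have : s * (y a - x a) <= 1 * (y a - x a) by rewrite ler_wpM2r// ltW.
    lra.
  have h1 : dot (grad U y) d <= dot (grad U z) d.
    by apply: dot_le => // a; exact: (cdr_grad_antitone hU).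
  have h2 : dot (grad U z) d <= (U z - U x) / s.
    have hlim := gradP (cdr_diff hU) z0 d d0.
    apply: (cvgr_to_le hlim).
    near=> e.
    have e0 : 0 < e by near: e; exact: nbhs_right_gt.
    rewrite ler_pdivrMr// mulrAC ler_pdivlMr// mulrC [leRHS]mulrC.
    exact: (concave_chord (cdr_concave hU)).
  have h3 : U z <= U y by exact: (cdr_monotone hU).
  rewrite ler_pdivlMr// in h2.
  have : dot (grad U y) d * s <= dot (grad U z) d * s.
    by rewrite ler_wpM2r// ltW.
  lra.
have Uxy : U x <= U y by exact: (cdr_monotone hU).
have [D0|D0] := leP (dot (grad U y) d) 0; first lra.
rewrite leNgt; apply/negP => hlt.
(* [r] is the value of [s] above which the bound [main] fails; the midpoint of [r] and 1 is such a
   value. *)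
set r := (U y - U x) / dot (grad U y) d.
have r1 : r < 1 by rewrite ltr_pdivrMr// mul1r.
have r0 : 0 <= r by rewrite divr_ge0 ?subr_ge0// ltW.
have /main : 0 < (r + 1) / 2 < 1 by lra.
rewrite leNgt => /negP; apply; rewrite -ltr_pdivrMr// -/r; lra.
Unshelve. all: by end_near.
Qed.

(** * Increments of the flow during one arrival *)

Lemma Rintegral_sum {R : realType} {d : measure_display}
    {T : measurableType d} (mu : {measure set T -> \bar R}) {I : Type}
    {D : set T} (s : seq I) {f : I -> T -> R} :
  measurable D -> (forall i, mu.-integrable D (EFin \o f i)) ->
  \int[mu]_(x in D) (\sum_(i <- s) f i x) =
  \sum_(i <- s) \int[mu]_(x in D) f i x.
Proof.
move=> mD fi.
(* The induction carries integrability of the partial sums, which additivity of the integral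
   requires. *)
suff [] : mu.-integrable D (EFin \o (fun x => \sum_(i <- s) f i x)) /\
  \int[mu]_(x in D) (\sum_(i <- s) f i x) =
  \sum_(i <- s) \int[mu]_(x in D) f i x by [].
elim: s => [|i s [IH1 IH2]].
  have E : (fun x => \sum_(i <- [::]) f i x) = cst (0 : R).
    by apply/funext => x; rewrite big_nil.
  rewrite big_nil E; split; first exact: integrable0.
  by rewrite Rintegral_cst// mul0r.
have E : (fun x => \sum_(i <- i :: s) f i x) =
    (fun x => f i x + \sum_(i <- s) f i x).
  by apply/funext => x; rewrite big_cons.
rewrite big_cons E; split; last by rewrite RintegralD// IH2.
exact: (integrableD mD (fi i) IH1).
Qed.

(** Trades rates and integrals for properties of increments. An option that never maximizes during
    [[s, t]] has rate 0 there, so its coordinate cannot grow. *)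
Lemma greedy_arrival_path {R : realType} {A : finType}
    {U : {ffun A -> R} -> R} {S : {set A}} {x y : {ffun A -> R}} :
  greedy_arrival U S x y ->
  exists X : R -> {ffun A -> R},
    [/\ X 0 = x, X 1 = y
      & forall s t, 0 <= s -> s <= t -> t <= 1 ->
        [/\ forall a, X s a <= X t a,
            \sum_a (X t a - X s a) = (t - s) * (S != finset.set0)%:R
          & forall a, X s a < X t a ->
              exists2 r, s <= r <= t & greedy_option U S (X r) a]].
Proof.
move=> [X [rho [mrho hrho hX ->]]]; exists X.
have rho1 t a : 0 <= t <= 1 -> rho t a <= 1.
  move=> t01; have [r0 _ rs] := hrho t t01.
  rewrite (le_trans (y := \sum_a rho t a)) ?rs ?lern1 ?leq_b1//.
  by rewrite -rs (bigD1 a)//= lerDl sumr_ge0.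
have irho (D : set R) a : measurable D -> (D `<=` `[0, 1])%classic ->
    lebesgue_measure.-integrable D (EFin \o (fun t => rho t a)).
  move=> mD D01.
  suff i01 : lebesgue_measure.-integrable `[0, 1]%classic
      (EFin \o (fun t => rho t a)) by exact: integrableS i01.
  apply: measurable_bounded_integrable => //.
    by rewrite /= lebesgue_measure_itv/= lte_fin ltr01 -EFinB ltry.
    exact: mrho.
  exists 1; split; rewrite ?num_real// => M M1 t /=.
  rewrite in_itv/= => t01; have [r0 _ _] := hrho t t01.
  by rewrite ger0_norm// (le_trans (rho1 t a t01))// ltW.
split => //.
  apply/ffunP => a; rewrite hX ?lexx ?ler01//.
  by rewrite set_itv1 Rintegral_set1 addr0.
move=> s t s0 st t1.
have sub01 : (`]s, t] `<=` `[0, 1])%classic.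
  move=> r /=; rewrite !in_itv/= => /andP[sr rt]; lra.
have incr a : X t a - X s a =
    \int[lebesgue_measure]_(r in `]s, t]) rho r a.
  rewrite !hX; [|lra|lra].
  rewrite opprD addrACA subrr add0r Rintegral_itvB//.
  apply: irho => //.
  by move=> r /=; rewrite !in_itv/= => /andP[sr rt]; lra.
split.
- move=> a; rewrite -subr_ge0 incr; apply: Rintegral_ge0 => r /sub01/=.
  by rewrite in_itv/= => /hrho[].
- under eq_bigr do rewrite incr.
  rewrite -Rintegral_sum//; last by move=> a; exact: irho.
  rewrite (@eq_Rintegral _ _ _ _ _ (cst (S != finset.set0)%:R)); last first.
    by move=> r; rewrite inE => /sub01/=; rewrite in_itv/= => /hrho[].
  rewrite Rintegral_cst//= lebesgue_measure_itv/= lte_fin mulrC.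
  (* When [s = t] the interval formula falls in its default case 0, which agrees with [t - s]. *)
  by congr (_ * _); move: st; case: ltgtP => //= -> _; rewrite subrr.
- move=> a Xst; apply: contrapT => nex.
  suff : X t a - X s a = 0 by lra.
  rewrite incr (@eq_Rintegral _ _ _ _ _ (cst 0)); last first.
    move=> r; rewrite inE => rst; have /= := sub01 _ rst.
    rewrite in_itv/= => /hrho[_ hgo _].
    apply/eqP/negPn/negP => /hgo hr; apply: nex; exists r => //.
    by move: rst; rewrite /= in_itv/= => /andP[/ltW -> ->].
  by rewrite Rintegral_cst// mul0r.
Qed.

Lemma greedy_arrival_le {R : realType} {A : finType} {U : {ffun A -> R} -> R}
    {S : {set A}} {x y : {ffun A -> R}} :
  greedy_arrival U S x y -> forall a, x a <= y a.
Proof.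
by move=> /greedy_arrival_path[X [<- <- /(_ 0 1 (lexx _) ler01 (lexx _))[]]].
Qed.

(** * Gain of one arrival, by refining partitions of the time interval *)

Lemma le_of_forall_divn {R : realType} (c d k : R) :
  (forall N : nat, (0 < N)%N -> c <= d + k / N%:R) -> c <= d.
Proof.
move=> h; apply/ler_addgt0Pr => e e0.
pose N := (Num.Def.archi_bound (k / e)).+1.
have N0 : (0 : R) < N%:R by rewrite ltr0n.
apply: (le_trans (h N isT)); rewrite lerD2l ler_pdivrMr// mulrC -ler_pdivrMr//.
by rewrite (le_trans (ltW (unstable.ltr_bound _)))// ler_nat.
Qed.

(* Cut [0, 1] into N pieces. On a piece the flow is only moved to options whose
   marginal is at least [grad U z b] at some time of the piece, so evaluating
   the marginals at its right end loses at most the drop of the marginals over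
   the piece times 1 / N. The drops telescope, so the total loss is O(1 / N),
   although [grad U] need not be continuous. *)
Lemma greedy_arrival_gain {R : realType} {A : finType} {U : {ffun A -> R} -> R}
    {S : {set A}} {x y z : {ffun A -> R}} (b : A) :
  CDR_valuation U -> orthant x -> greedy_arrival U S x y ->
  (forall a, y a <= z a) -> b \in S -> grad U z b <= U y - U x.
Proof.
move=> hU x0 /greedy_arrival_path[X [X0 X1 hX]] yz bS.
have XX s t : 0 <= s -> s <= t -> t <= 1 -> forall a, X s a <= X t a.
  by move=> s0 st t1; case: (hX s t).
have oX t : 0 <= t <= 1 -> orthant (X t).
  move=> /andP[t0 t1]; apply: (orthant_le x0); rewrite -X0; exact: XX.
set c := grad U z b.
have Sn0 : S != finset.set0 by apply/set0Pn; exists b.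
pose drop s t := \sum_a (grad U (X s) a - grad U (X t) a).
have piece s t : 0 <= s -> s <= t -> t <= 1 ->
    c * (t - s) - drop s t * (t - s) <= U (X t) - U (X s).
  move=> s0 st t1; have [mono tot opt] := hX s t s0 st t1.
  have os : orthant (X s) by apply: oX; lra.
  apply: le_trans (grad_le_increment hU os mono).
  rewrite Sn0 mulr1 in tot.
  (* Writing the first [t - s] as the total flow reduces the claim to one inequality per option. *)
  rewrite -{1}tot /drop mulr_suml mulr_sumr -sumrB /dot.
  apply: ler_sum => a _; rewrite !ffunE.
  have ot : orthant (X t) by apply: oX; lra.
  have da : grad U (X t) a <= grad U (X s) a by exact: (cdr_grad_antitone hU).
  have := mono a; rewrite le_eqVlt => /predU1P[->|lta].
    by rewrite subrr !mulr0 add0r oppr_le0 mulr_ge0// subr_ge0.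
  have [r /andP[sr rt] [_ /(_ b bS) gr]] := opt a lta.
  (* At time [r] option [a] is at least as good as [b], and [X s <= X r <= X 1 <= z]
     coordinate-wise. *)
  have ca : c <= grad U (X s) a.
    have orr : orthant (X r) by apply: oX; lra.
    apply: (@le_trans _ _ (grad U (X r) b)).
      apply: (cdr_grad_antitone hU) => //.
        apply: (orthant_le orr) => a'; apply: le_trans (yz a').
        by rewrite -X1; apply: XX => //; lra.
      move=> a'; apply: le_trans (yz a'); rewrite -X1; apply: XX => //; lra.
    apply: (le_trans gr); apply: (cdr_grad_antitone hU) => //.
    by apply: XX => //; lra.
  (* One option receives at most the whole flow, so its drop may be weighted by the length of the
     piece. *)
  have le_len : X t a - X s a <= t - s.
    rewrite -tot (bigD1 a)//= lerDl sumr_ge0// => a' _.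
    by rewrite subr_ge0 mono.
  have h1 : (grad U (X s) a - grad U (X t) a) * (X t a - X s a) <=
      (grad U (X s) a - grad U (X t) a) * (t - s).
    by rewrite ler_wpM2l// subr_ge0.
  have h2 : c * (X t a - X s a) <= grad U (X s) a * (X t a - X s a).
    by rewrite ler_wpM2r// subr_ge0 ltW.
  lra.
apply: (@le_of_forall_divn _ _ _ (drop 0 1)) => N N0.
have N0' : (0 : R) < N%:R by rewrite ltr0n.
pose p (i : nat) : R := i%:R / N%:R.
have pS i : p i.+1 - p i = N%:R^-1 by rewrite /p -mulrBl -natrB// subSnn mul1r.
have p0 : p 0%N = 0 by rewrite /p mul0r.
have pN : p N = 1 by rewrite /p divff// gt_eqF.
have : \sum_(0 <= i < N) (c / N%:R - drop (p i) (p i.+1) / N%:R) <=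
    \sum_(0 <= i < N) (U (X (p i.+1)) - U (X (p i))).
  rewrite big_nat [leRHS]big_nat; apply: ler_sum => i /= iN.
  rewrite -(pS i); apply: piece.
  - by rewrite divr_ge0// ler0n.
  - by rewrite -subr_ge0 pS invr_ge0 ltW.
  - by rewrite ler_pdivrMr// mul1r ler_nat.
rewrite (telescope_sumr (fun i => U (X (p i)))) // pN p0 X0 X1.
rewrite sumrB -[X in _ - X]mulr_suml sumr_const_nat subn0.
rewrite -[_ *+ N]mulr_natr divfK ?gt_eqF//.
have -> : \sum_(0 <= i < N) drop (p i) (p i.+1) = drop 0 1.
  rewrite /drop exchange_big/=; apply: eq_bigr => a _.
  have := telescope_sumr (fun i => - grad U (X (p i)) a) (leq0n N).
  rewrite pN p0 opprK addrC => <-; apply: eq_bigr => i _.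
  by rewrite opprK addrC.
by rewrite lerBlDr.
Qed.

(** * Summation over the items and competitiveness *)

Lemma sum_over_instance {R : realType} {A : finType} {n : nat}
    {opts : 'I_n -> {set A}} (F : A -> R) :
  ocdra_instance opts -> \sum_a F a = \sum_j \sum_(a in opts j) F a.
Proof.
move=> [disj cover].
under [RHS]eq_bigr do rewrite big_mkcond.
rewrite exchange_big/=; apply: eq_bigr => a _.
have [j aj] := cover a.
rewrite (bigD1 j)//= aj big1 ?addr0// => i ij.
case: ifP => // ai.
by have /setP/(_ a) := disj _ _ ij; rewrite !inE ai aj.
Qed.

Lemma continuous_greedy_gain {R : realType} {A : finType} {n : nat}
    {opts : 'I_n -> {set A}} {U : {ffun A -> R} -> R}
    {x xstar : {ffun A -> R}} :
  ocdra_instance opts -> CDR_valuation U -> continuous_greedy U opts x ->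
  feasible opts xstar -> orthant x /\ dot (grad U x) xstar <= U x.
Proof.
move=> hinst hU [xs [xs0 hxs xsn]] [xstar0 hfeas].
have step i : (i < n)%N -> forall a, xs i a <= xs i.+1 a.
  by move=> lin; exact: greedy_arrival_le (hxs (Ordinal lin)).
have oxs i : (i <= n)%N -> orthant (xs i).
  elim: i => [_|i IH lin]; first by rewrite xs0 => a; rewrite ffunE.
  exact: (orthant_le (IH (ltnW lin)) (step i lin)).
have xsx i : (i <= n)%N -> forall a, xs i a <= x a.
  move=> lin a; rewrite -xsn -(subKn lin).
  elim: (n - i)%N => [|k IH]; first by rewrite subn0.
  (* Subtraction is truncated: once [n <= k], both [n - k.+1] and [n - k] are 0. *)
  have [nk|kn] := leqP n k.
    by rewrite (_ : n - k.+1 = n - k)%N//; lia.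
  apply: le_trans IH; rewrite -(subnSK kn); apply: step; lia.
split; first by rewrite -xsn; exact: oxs.
have -> : U x = \sum_(j < n) (U (xs j.+1) - U (xs j)).
  rewrite -(big_mkord xpredT (fun j => U (xs j.+1) - U (xs j))).
  by rewrite (telescope_sumr (fun j => U (xs j)))// xs0 xsn (cdr_0 hU) subr0.
rewrite /dot (sum_over_instance _ hinst); apply: ler_sum => j _.
(* [xstar] may put total weight below 1 on an item, so the sign of the gain matters when that weight
   is bounded by 1. *)
have Uj : 0 <= U (xs j.+1) - U (xs j).
  rewrite subr_ge0; apply: (cdr_monotone hU); [exact/oxs/ltnW|exact: oxs|].
  exact: step.
apply: (@le_trans _ _ (\sum_(a in opts j) (U (xs j.+1) - U (xs j)) * xstar a)).
  apply: ler_sum => a aj; rewrite ler_wpM2r//.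
  apply: (greedy_arrival_gain _ hU _ (hxs j) _ aj); first exact/oxs/ltnW.
  exact: xsx.
by rewrite -mulr_sumr ler_piMr.
Qed.

Theorem theorem3p5 (R : realType) (A : finType) (n : nat)
    (opts : 'I_n -> {set A}) (f U : {ffun A -> R} -> R) (gamma : R)
    (hinst : ocdra_instance opts)
    (hf : CDR_valuation f)
    (hgamma : 0 <= gamma <= 1)
    (hU : balanced gamma f U)
    (x : {ffun A -> R}) (hx : continuous_greedy U opts x)
    (xstar : {ffun A -> R}) (hxstar : feasible opts xstar) :
  gamma * f xstar <= f x.
Proof.
have [hCDR hbal] := hU.
have [x0 gain] := continuous_greedy_gain hinst hCDR hx hxstar.
have [xstar0 _] := hxstar.
(* For [gamma = 0] the inverse is +oo and cannot be cleared, but the claim is then [0 <= f x]. *)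
have /andP[] := hgamma; rewrite le_eqVlt => /predU1P[<- _|g0 _].
  by rewrite mul0r; exact: (cdr_ge0 hf).
have hfhat : ((f xstar - dot (grad U x) xstar)%:E <= fhat f (grad U x))%E.
  by apply: ereal_sup_ubound; exists xstar.
have := le_trans (leeD2l (U x)%:E hfhat) (hbal x x0).
rewrite inver gt_eqF// -EFinD -EFinM lee_fin ler_pdivlMl// => h.
apply: le_trans h; rewrite ler_pM2l//; lra.
Qed.
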